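(* Let $X$ and $Y$ be Banach spaces. If $X$ is almost square, then the injective tensor product $X\widehat{\otimes}_\varepsilon Y$ is almost square. In particular, $X\widehat{\otimes}_\varepsilon Y$ has the strong diameter two property.
   Context: All Banach spaces are real and non-zero. $B_X$ and $S_X$ denote the closed unit ball and the unit sphere of $X$. The injective tensor product $X\widehat{\otimes}_\varepsilon Y$ is the completion of $X\otimes Y$ under the norm $\|u\|:=\sup\{|\sum_{i=1}^n x^*(x_i)y^*(y_i)| : x^*\in S_{X^*},\ y^*\in S_{Y^*}\}$, where $u=\sum_{i=1}^n x_i\otimes y_i$. A Banach space $X$ is almost square (ASQ) if for every $x_1,\ldots,x_k\in S_X$ there exists a sequence $\{y_n\}$ in $B_X$ such that $\|y_n\|\to 1$ and $\|x_i\pm y_n\|\to 1$ for every $i\in\{1,\ldots,k\}$. A slice of $B_X$ is a set $\{x\in B_X: x^*(x)>1-\alpha\}$ with $x^*\in S_{X^*}$ and $\alpha>0$. $X$ has the strong diameter two property (SD2P) if each finite convex combination of slices of $B_X$ (i.e. each set $\sum_{i=1}^n\lambda_i S_i$ with $S_i$ slices, $\lambda_i\ge 0$, $\sum_i\lambda_i=1$) has diameter two. *)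

(* Defs.v *)
From HB Require Import structures.
From mathcomp Require Import all_boot all_order all_algebra.
From mathcomp Require Import all_classical all_reals all_analysis.

Set Implicit Arguments.
Unset Strict Implicit.
Unset Printing Implicit Defensive.

Import Order.TTheory GRing.Theory Num.Theory.
Import numFieldNormedType.Exports.

Local Open Scope classical_set_scope.
Local Open Scope ring_scope.

Definition unit_ball {R : realType} (X : normedModType R) : set X :=
  [set x | `|x| <= 1].
Arguments unit_ball {R} X.

Definition unit_sphere {R : realType} (X : normedModType R) : set X :=
  [set x | `|x| = 1].
Arguments unit_sphere {R} X.

Definition dual_norm {R : realType} (X : normedModType R) (f : X -> R^o) : R :=
  sup [set `|f x| | x in unit_ball X].

(* For a discontinuous f the supremum defining [dual_norm f] is taken over an
   unbounded set and equals 0 by convention. *)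
Definition dual_sphere {R : realType} (X : normedModType R) :
    set {linear X -> R^o} :=
  [set f | continuous f /\ dual_norm f = 1].
Arguments dual_sphere {R} X.

Definition almost_square {R : realType} (X : normedModType R) : Prop :=
  forall (k : nat) (x : 'I_k -> X), (forall i, unit_sphere X (x i)) ->
  exists y : nat -> X,
    [/\ forall n, unit_ball X (y n),
        `|y n| @[n --> \oo] --> (1 : R) &
        forall i, `|x i + y n| @[n --> \oo] --> (1 : R) /\
                  `|x i - y n| @[n --> \oo] --> (1 : R)].

Definition is_slice {R : realType} (X : normedModType R) (S : set X) : Prop :=
  exists (f : {linear X -> R^o}) (a : R),
    [/\ dual_sphere X f, 0 < a &
        S = [set x | unit_ball X x /\ 1 - a < f x]].

Definition diameter {R : realType} (X : normedModType R) (A : set X) : \bar R :=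
  ereal_sup [set (`|u - v|)%:E | u in A & v in A].

Definition strong_diameter_two {R : realType} (X : normedModType R) : Prop :=
  forall (n : nat) (lam : 'I_n -> R) (S : 'I_n -> set X),
    (forall i, is_slice (S i)) ->
    (forall i, 0 <= lam i) -> \sum_i lam i = 1 ->
    diameter [set \sum_i lam i *: s i | s in [set s : 'I_n -> X |
                                              forall i, S i (s i)]] = 2%:E.

(* The algebraic tensor product: x (x) y is the evaluation B |-> B x y on the
   space of bilinear forms, and [tensor X Y] is the span of these evaluations.
   Since bilinear forms separate the points of the tensor product of two vector
   spaces, this is a model of it.  Scalars are absorbed in the left factors, so
   the span consists of the finite sums of elementary tensors. *)
Section AlgebraicTensorProduct.
Context {R : realType}.
Variables (X Y : lmodType R).

Definition is_tensor : {pred {bilinear X -> Y -> R^o} -> R^o} := fun phi =>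
  `[< exists (n : nat) (x : 'I_n -> X) (y : 'I_n -> Y),
        phi = fun B => \sum_i B (x i) (y i) >].

Record tensor := Tensor {
  tensor_val :> {bilinear X -> Y -> R^o} -> R^o;
  _ : tensor_val \in is_tensor }.

HB.instance Definition _ := [isSub for tensor_val].
HB.instance Definition _ := [Choice of tensor by <:].

Lemma is_tensor_submod_closed : submod_closed is_tensor.
Proof.
split.
  apply/asboolP; exists 0%N, (fun=> 0), (fun=> 0).
  by apply/funext => B; rewrite big_ord0.
move=> a _ _ /asboolP[n [x [y ->]]] /asboolP[m [x' [y' ->]]].
apply/asboolP; exists (n + m)%N.
exists (fun i => match fintype.split i with inl j => a *: x j | inr j => x' j end).
exists (fun i => match fintype.split i with inl j => y j | inr j => y' j end).
apply/funext => B; rewrite big_split_ord /=; congr (_ + _).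
  rewrite -[LHS]/(a * _) mulr_sumr; apply: eq_bigr => i _.
  by rewrite (unsplitK (inl i)) linearZl_LR.
by apply: eq_bigr => i _; rewrite (unsplitK (inr i)).
Qed.

HB.instance Definition _ := GRing.isSubmodClosed.Build _ _ is_tensor
  is_tensor_submod_closed.
HB.instance Definition _ := [SubChoice_isSubLmodule of tensor by <:].

Lemma is_tensor_elementary (x : X) (y : Y) :
  (fun B : {bilinear X -> Y -> R^o} => B x y) \in is_tensor.
Proof.
apply/asboolP; exists 1%N, (fun=> x), (fun=> y).
by apply/funext => B; rewrite big_ord1.
Qed.

Definition tens (x : X) (y : Y) : tensor := Tensor (is_tensor_elementary x y).

Lemma tensor_sumE (n : nat) (x : 'I_n -> X) (y : 'I_n -> Y) B :
  (\sum_i tens (x i) (y i) : tensor) B = \sum_i B (x i) (y i).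
Proof.
rewrite -[LHS]/(val (\sum_i tens (x i) (y i)) B).
by rewrite raddf_sum fct_sumE.
Qed.

Lemma tensorP (u : tensor) :
  exists (n : nat) (x : 'I_n -> X) (y : 'I_n -> Y), u = \sum_i tens (x i) (y i).
Proof.
case: u => phi phiP; have /asboolP[n [x [y phiE]]] := phiP.
exists n, x, y; apply/val_inj; rewrite /= phiE; apply/funext => B.
exact/esym/tensor_sumE.
Qed.

Lemma tens_bilinear : bilinear_for *:%R *:%R tens.
Proof.
split=> [y|x] a u v; apply/val_inj/funext => B /=.
  by rewrite linearPl.
by rewrite linearPr.
Qed.

Section RankOneForm.
Variables (f : {linear X -> R^o}) (g : {linear Y -> R^o}).

Definition form_tens (x : X) (y : Y) : R^o := f x * g y.

Lemma form_tens_bilinear : bilinear_for *:%R *:%R form_tens.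
Proof.
split=> [y|x] a u v; rewrite /form_tens linearP.
  by rewrite mulrDl -[a *: f u]/(a * f u) -mulrA.
by rewrite mulrDr -[a *: g u]/(a * g u) mulrCA.
Qed.

HB.instance Definition _ :=
  bilinear_isBilinear.Build R X Y R^o *:%R *:%R form_tens form_tens_bilinear.

End RankOneForm.

End AlgebraicTensorProduct.

Section InjectiveTensorProduct.
Context {R : realType}.
Variables (X Y : normedModType R).

Definition injective_norm (u : tensor X Y) : R :=
  sup [set r | exists (f : {linear X -> R^o}) (g : {linear Y -> R^o}),
    [/\ dual_sphere X f, dual_sphere Y g & r = `|u (form_tens f g)|]].

Lemma injective_normE (n : nat) (x : 'I_n -> X) (y : 'I_n -> Y) :
  injective_norm (\sum_i tens (x i) (y i)) =
  sup [set r | exists (f : {linear X -> R^o}) (g : {linear Y -> R^o}),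
    [/\ dual_sphere X f, dual_sphere Y g & r = `|\sum_i f (x i) * g (y i)|]].
Proof.
rewrite /injective_norm; congr sup; apply/seteqP.
by split=> _ [f [g [fS gS ->]]]; exists f, g; rewrite tensor_sumE.
Qed.

(* A completion is only determined up to a linear isometry, so the injective
   tensor product of X and Y is any Banach space Z with such an embedding j;
   one exists, see [injective_tensor_product_exists] below. *)
Definition is_injective_tensor_product (Z : completeNormedModType R)
    (j : {linear tensor X Y -> Z}) : Prop :=
  (forall u, `|j u| = injective_norm u) /\ dense (range j).

End InjectiveTensorProduct.

Lemma dual_sphere_le {R : realType} (X : normedModType R)
    (f : {linear X -> R^o}) (x : X) : dual_sphere X f -> `|f x| <= `|x|.
Proof.
move=> [fc f1]; have [->|x0] := eqVneq x 0; first by rewrite linear0 !normr0.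
have x0' : 0 < `|x| by rewrite normr_gt0.
suff : `|f (`|x|^-1 *: x)| <= 1.
  by rewrite linearZ /= normrZ ger0_norm ?invr_ge0 // ler_pdivrMl // mulr1.
rewrite -f1; apply: sup_upper_bound; last first.
  exists (`|x|^-1 *: x) => //.
  by rewrite /unit_ball /= normrZ ger0_norm ?invr_ge0 // mulVf // gt_eqF.
split; first by exists `|f 0|, 0; rewrite // /unit_ball /= normr0.
have /bounded_funP/(_ 1)[M Mf] := continuous_linear_bounded 0 (fc 0).
by exists M => _ [y y1 <-]; exact: Mf.
Qed.

(* Existence of the completion: the uniform closure of the algebraic tensor
   product inside the bounded functions on the product of the dual spheres. *)
Module Completion.
Section Completion.
Context {R : realType}.
Variables (X Y : normedModType R).

Definition index : Type :=
  {f | dual_sphere X f} * {g | dual_sphere Y g}.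

Definition ev (u : tensor X Y) : index -> R^o :=
  fun d => u (form_tens (sval d.1) (sval d.2)).

Definition is_limit : {pred index -> R^o} := fun z =>
  `[< forall e : R, 0 < e -> exists u, forall d, `|z d - ev u d| <= e >].

Record space := Space { val_space :> index -> R^o; _ : val_space \in is_limit }.

HB.instance Definition _ := [isSub for val_space].
HB.instance Definition _ := [Choice of space by <:].

Lemma evP a u v d : ev (a *: u + v) d = a * ev u d + ev v d.
Proof. by []. Qed.

Lemma is_limit_submod_closed : submod_closed is_limit.
Proof.
split.
  apply/asboolP => e e0; exists 0 => d.
  by rewrite -[ev 0 d]/(0 : R) subrr normr0 ltW.
move=> a z w /asboolP zP /asboolP wP; apply/asboolP => e e0.
have a0 : 0 < `|a| + 1 by rewrite ltr_wpDl.
have e1 : 0 < e / 2 / (`|a| + 1) by rewrite !divr_gt0.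
have e2 : 0 < e / 2 by rewrite divr_gt0.
have [u uP] := zP _ e1; have [v vP] := wP _ e2.
exists (a *: u + v) => d; rewrite evP.
rewrite -[(a *: z + w) d]/(a * z d + w d) opprD addrACA -mulrBr.
rewrite [e in _ <= e]splitr (le_trans (ler_normD _ _)) // lerD // normrM.
apply: (@le_trans _ _ ((`|a| + 1) * (e / 2 / (`|a| + 1)))).
  by apply: ler_pM => //; rewrite lerDl.
by rewrite mulrC divfK // gt_eqF.
Qed.

HB.instance Definition _ := GRing.isSubmodClosed.Build _ _ is_limit
  is_limit_submod_closed.
HB.instance Definition _ := [SubChoice_isSubLmodule of space by <:].

Lemma ev_bounded u : exists M, forall d, `|ev u d| <= M.
Proof.
have [n [x [y ->]]] := tensorP u.
exists (\sum_i `|x i| * `|y i|) => -[[f fS] [g gS]].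
rewrite /ev tensor_sumE (le_trans (ler_norm_sum _ _ _)) //.
apply: ler_sum => i _; rewrite /= /form_tens normrM.
by apply: ler_pM => //; exact: dual_sphere_le.
Qed.

Lemma space_bounded (z : space) : exists M, forall d, `|z d| <= M.
Proof.
case: z => z zP; have /asboolP/(_ 1 ltr01)[u uP] := zP.
have [M MP] := ev_bounded u; exists (1 + M) => d /=.
by rewrite -[z d](subrK (ev u d)) (le_trans (ler_normD _ _)) // lerD.
Qed.

Definition norm (z : space) : R := sup [set `|z d| | d in setT].

Lemma norm_ub (z : space) d : `|z d| <= norm z.
Proof.
apply: sup_upper_bound; last by exists d.
split; first by exists `|z d|, d.
by have [M MP] := space_bounded z; exists M => _ [d' _ <-].
Qed.

Lemma norm_le (z : space) (c : R) : 0 <= c -> (forall d, `|z d| <= c) -> norm z <= c.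
Proof.
move=> c0 zc; rewrite /norm.
have [->|/set0P A0] := eqVneq [set `|z d| | d in setT] set0; first by rewrite sup0.
by apply: ge_sup => // _ [d _ <-].
Qed.

Lemma norm_ge0 z : 0 <= norm z.
Proof.
rewrite /norm; have [->|/set0P[_ [d _ _]]] := eqVneq [set `|z d| | d in setT] set0.
  by rewrite sup0.
exact: le_trans (normr_ge0 _) (norm_ub z d).
Qed.

Lemma normD z w : norm (z + w) <= norm z + norm w.
Proof.
apply: norm_le => [|d]; first by rewrite addr_ge0 ?norm_ge0.
by rewrite (le_trans (ler_normD _ _)) // lerD // norm_ub.
Qed.

Lemma normZ_le (a : R) z : norm (a *: z) <= `|a| * norm z.
Proof.
apply: norm_le => [|d]; first by rewrite mulr_ge0 ?norm_ge0.
by rewrite -[(a *: z) d]/(a * z d) normrM ler_wpM2l // norm_ub.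
Qed.

Lemma normZ (a : R) z : norm (a *: z) = `|a| * norm z.
Proof.
apply/eqP; rewrite eq_le normZ_le /=.
have [->|a0] := eqVneq a 0; first by rewrite normr0 mul0r norm_ge0.
rewrite -ler_pdivlMl ?normr_gt0 // -normfV -[in leLHS](scalerK a0 z).
exact: normZ_le.
Qed.

Lemma norm_eq0 z : norm z = 0 -> z = 0.
Proof.
move=> z0; apply/val_inj/funext => d; apply/eqP; rewrite -normr_le0.
by have := norm_ub z d; rewrite z0.
Qed.

HB.instance Definition _ := Lmodule_isNormed.Build R space normD normZ norm_eq0.

Lemma le_norm (z : space) d : `|z d| <= `|z|.
Proof. exact: norm_ub. Qed.

Lemma space_complete (F : set_system space) :
  ProperFilter F -> cauchy F -> cvg F.
Proof.
move=> FF Fc.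
have Fball (e : R) : 0 < e -> exists z0 : space, F [set z | `|z0 - z| < e].
  move=> e0; have /cauchyP/(_ e e0)[z0 Fz0] := Fc.
  by exists z0; move: Fz0; rewrite -ball_normE.
have cvd d : cvg ((fun z : space => z d : R) @ F).
  apply: cauchy_cvg; apply/cauchyP => e e0.
  have [z0 Fz0] := Fball e e0; exists (z0 d).
  change (F [set z : space | ball (z0 d : R) e (z d)]).
  apply: filterS Fz0 => z /= z0z.
  by rewrite -ball_normE /=; apply: le_lt_trans z0z; exact: (le_norm (z0 - z) d).
pose l d : R^o := lim ((fun z : space => z d : R) @ F).
have lP (z0 : space) (e : R) d : F [set z | `|z0 - z| < e] ->
    `|z0 d - l d| <= e.
  move=> Fz0.
  have : (fun z : space => `|z0 d - z d|) @ F --> `|z0 d - l d|.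
    by apply: cvg_norm; apply: cvgB; [exact: cvg_cst|exact: cvd].
  move=> /cvg_lim <- //; apply: limr_le.
    by apply: is_cvg_norm; apply: is_cvgB; [exact: is_cvg_cst|exact: cvd].
  apply: filterS Fz0 => z /= /ltW; apply: le_trans; exact: (le_norm (z0 - z) d).
have l_limit : l \in is_limit.
  apply/asboolP => e e0; have e2 : 0 < e / 2 by rewrite divr_gt0.
  have [z0 Fz0] := Fball _ e2.
  have /asboolP/(_ _ e2)[u uP] : val z0 \in is_limit := valP z0.
  exists u => d; rewrite distrC -(subrKA (z0 d)) [e in _ <= e]splitr.
  by rewrite (le_trans (ler_normD _ _)) // lerD ?lP // distrC.
apply/cvg_ex; exists (Space l_limit); apply/cvgrPdist_le => e e0.
have e2 : 0 < e / 2 by rewrite divr_gt0.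
have [z0 Fz0] := Fball _ e2.
apply: filterS (Fz0) => z /= z0z; rewrite -(subrKA z0) [e in _ <= e]splitr.
rewrite (le_trans (ler_normD _ _)) // lerD //; last exact: ltW.
apply: (norm_le (z := Space l_limit - z0)) => [|d]; first exact: ltW.
by rewrite -[(_ - z0) d]/(l d - z0 d) distrC lP.
Qed.

HB.instance Definition _ := Uniform_isComplete.Build space space_complete.

Lemma ev_is_limit u : ev u \in is_limit.
Proof.
by apply/asboolP => e e0; exists u => d; rewrite subrr normr0 ltW.
Qed.

Definition embed (u : tensor X Y) : space := Space (ev_is_limit u).

Lemma embed_linear : linear embed.
Proof. by move=> a u v; apply/val_inj/funext. Qed.

HB.instance Definition _ :=
  GRing.isLinear.Build R (tensor X Y) space *:%R embed embed_linear.

Lemma embedP :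
  is_injective_tensor_product (embed : {linear tensor X Y -> space}).
Proof.
split=> [u|].
  rewrite -[LHS]/(norm _) /norm /injective_norm; congr sup; apply/seteqP; split.
    by move=> _ [[[f fS] [g gS]] _ <-]; exists f, g.
  by move=> _ [f [g [fS gS ->]]]; exists (exist _ f fS, exist _ g gS).
move=> O [z Oz] Oo; have /nbhs_normP[e /= e0 eO] : nbhs z O.
  exact: open_nbhs_nbhs.
have e2 : 0 < e / 2 by rewrite divr_gt0.
have /asboolP/(_ _ e2)[u uP] : val z \in is_limit := valP z.
exists (embed u); split; last by exists u.
apply: eO; apply: (@le_lt_trans _ _ (e / 2)); last by rewrite ltr_pdivrMr // ltr_pMr // ltr1n.
by apply: (norm_le (z := z - embed u)) => //; exact: ltW.
Qed.

Lemma completion_exists :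
  exists (Z : completeNormedModType R) (j : {linear tensor X Y -> Z}),
    is_injective_tensor_product j.
Proof. by exists space, embed; exact: embedP. Qed.

End Completion.
End Completion.

Lemma injective_tensor_product_exists {R : realType} (X Y : normedModType R) :
  exists (Z : completeNormedModType R) (j : {linear tensor X Y -> Z}),
    is_injective_tensor_product j.
Proof. exact: Completion.completion_exists. Qed.

(* Main.v *)
(* Given norm-one z_1, ..., z_k in the injective tensor product, approximate them
   by algebraic tensors u_i.  The elements (id (x) g)(u_i) of X, for g in the dual
   sphere of Y, form a totally bounded set, so X being almost square provides
   one almost norm-one y with |x + b y| <= (1 + e) max(|x|, |b|) for (almost)
   all those x and all scalars b.  For a unit vector v of Y, testing
   u_i +- y (x) v against f (x) g gives f(x +- g(v) y) with x = (id (x) g)(u_i),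
   hence |u_i +- y (x) v| is almost bounded by 1.

   For the strong diameter two property, choose norm-one x_i in the slices with
   f_i(x_i) almost 1; |x_i +- y| <= 1 + e forces f_i(y) to be small, so the
   suitably rescaled points x_i + y and x_i - y stay in the slices.

   Norming functionals are found as minimal sublinear functionals below the
   norm: minimality forces p(- y) = - p(y), hence linearity. *)
Require Import Defs.
From HB Require Import structures.
From mathcomp Require Import all_boot all_order all_algebra.
From mathcomp Require Import all_classical all_reals all_analysis.
From mathcomp Require Import lra ring.

Set Implicit Arguments.
Unset Strict Implicit.
Unset Printing Implicit Defensive.

Import Order.TTheory GRing.Theory Num.Theory.
Import numFieldNormedType.Exports.

Local Open Scope classical_set_scope.
Local Open Scope ring_scope.

(** * Minimal sublinear functionals *)

Section Sublinear.
Context {R : realType} {X : lmodType R}.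
Implicit Types p q : X -> R.

Definition sublinear p : Prop :=
  (forall x y, p (x + y) <= p x + p y) /\
  (forall a x, 0 <= a -> p (a *: x) <= a * p x).

Lemma sublinear_oppr p : sublinear p -> forall x, 0 <= p x + p (- x).
Proof.
move=> [pD pZ] x; have := pD x (- x); have := pD 0 0.
by rewrite subrr addr0; lra.
Qed.

Lemma sublinear_scale p : sublinear p ->
  forall a x, 0 <= a -> p (a *: x) = a * p x.
Proof.
move=> sp a x a0; have [pD pZ] := sp; apply/eqP; rewrite eq_le pZ //=.
have [->|aN0] := eqVneq a 0.
  by have := pD 0 0; rewrite mul0r scale0r addr0; lra.
have a_gt0 : 0 < a by rewrite lt_def aN0.
by rewrite -ler_pdivlMl // -[x in leLHS](scalerK aN0) pZ // invr_ge0.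
Qed.

(** Used for [directional_inf] and for lower bounds of chains. The index [k] may depend on the
    points, so that the family only has to be directed in a weak sense. The lower bounds [m] matter
    because [inf] of an unbounded set is 0 by default. *)
Lemma sublinear_inf (I : Type) (i0 : I) (q : I -> X -> R) :
  (forall x, exists m, forall i, m <= q i x) ->
  (forall i j x y, exists k, q k (x + y) <= q i x + q j y) ->
  (forall i a x, 0 <= a -> exists k, q k (a *: x) <= a * q i x) ->
  sublinear (fun x => inf (range (q ^~ x))).
Proof.
move=> lbq qD qZ.
have infle i x : inf (range (q ^~ x)) <= q i x.
  apply: ge_inf; last by exists i.
  by have [m mP] := lbq x; exists m => _ [j _ <-].
have leinf c x : (forall i, c <= q i x) -> c <= inf (range (q ^~ x)).
  move=> cq; apply: lb_le_inf; first by exists (q i0 x), i0.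
  by move=> _ [i _ <-].
split=> [x y|a x a0].
  rewrite -lerBlDr; apply: (leinf) => i.
  rewrite lerBlDl -lerBlDr; apply: (leinf) => j.
  rewrite lerBlDl; have [k] := qD i j x y.
  by rewrite addrC; apply: le_trans; exact: infle.
have [a_eq0|aN0] := eqVneq a 0.
  have [k] := qZ i0 a x a0; rewrite a_eq0 !mul0r.
  by apply: le_trans; exact: infle.
have a_gt0 : 0 < a by rewrite lt_def aN0.
rewrite -ler_pdivrMl //; apply: leinf => i; rewrite ler_pdivrMl //.
by have [k] := qZ i a x a0; apply: le_trans; exact: infle.
Qed.

(* The largest sublinear functional below [p] whose value at [- y] is at most
   [- p y]. *)
Definition directional_inf p (y x : X) : R :=
  inf (range (fun t : {t : R | 0 <= t} => p (x + sval t *: y) - sval t * p y)).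

(** Write [t *: y] as the sum of [x + t *: y] and [- x]. The bound does not depend on [t], so the
    infimum in [directional_inf] is a genuine one. *)
Lemma directional_lb p y x t : sublinear p -> 0 <= t ->
  - p (- x) <= p (x + t *: y) - t * p y.
Proof.
move=> sp t0; rewrite -(sublinear_scale sp) //; have := sp.1 (x + t *: y) (- x).
by rewrite addrAC subrr add0r; lra.
Qed.

Lemma directional_inf_le p y x t : sublinear p -> 0 <= t ->
  directional_inf p y x <= p (x + t *: y) - t * p y.
Proof.
move=> sp t0; apply: ge_inf; last by exists (exist _ t t0).
by exists (- p (- x)) => _ [[s s0] _ <-]; exact: directional_lb.
Qed.

Lemma sublinear_directional_inf p y :
  sublinear p -> sublinear (directional_inf p y).
Proof.
move=> sp; apply: (sublinear_inf (exist _ 0 (lexx 0) : {t : R | 0 <= t})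
  (q := fun t x => p (x + sval t *: y) - sval t * p y)).
- by move=> x; exists (- p (- x)) => -[t t0]; exact: directional_lb.
- move=> [t t0] [s s0] x x'.
  exists (exist _ (t + s) (addr_ge0 t0 s0) : {t : R | 0 <= t}) => /=.
  have := sp.1 (x + t *: y) (x' + s *: y).
  by rewrite addrACA -scalerDl mulrDl; lra.
- move=> [t t0] a x a0.
  exists (exist _ (a * t) (mulr_ge0 a0 t0) : {t : R | 0 <= t}) => /=.
  have := sp.2 a (x + t *: y) a0.
  by rewrite scalerDr scalerA -mulrA mulrBr; lra.
Qed.

(* A minimal [p] coincides with [directional_inf p y] for every [y], so that
   [p (- y) <= - p y]. *)
Lemma minimal_sublinear_linear p : sublinear p ->
  (forall q, sublinear q -> (forall x, q x <= p x) -> q = p) ->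
  linear (p : X -> R^o).
Proof.
move=> sp pmin.
have pN y : p (- y) = - p y.
  have qp : directional_inf p y = p.
    apply: pmin => [|x]; first exact: sublinear_directional_inf.
    have := directional_inf_le y x sp (lexx 0).
    by rewrite scale0r mul0r addr0 subr0.
  have := directional_inf_le y (- y) sp ler01; rewrite qp scale1r mul1r addNr.
  have := sublinear_oppr sp y; have := sublinear_scale sp 0 (lexx 0).
  by rewrite scale0r mul0r => ->; lra.
have pD x y : p (x + y) = p x + p y.
  have := sp.1 (- x) (- y); rewrite -opprD !pN.
  by have := sp.1 x y; lra.
have pZ a x : p (a *: x) = a * p x.
  have [a0|a0] := leP 0 a; first exact: sublinear_scale.
  by rewrite -[a]opprK scaleNr pN sublinear_scale ?mulNr // oppr_ge0 ltW.
by move=> a x y; rewrite pD pZ.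
Qed.

Lemma minimal_sublinear_exists p0 : sublinear p0 ->
  exists2 p, sublinear p & (forall x, p x <= p0 x) /\
    forall q, sublinear q -> (forall x, q x <= p x) -> q = p.
Proof.
move=> sp0; pose P p := sublinear p /\ forall x, p x <= p0 x.
pose T := {p | P p}.
(* The order is reversed: a maximal element in the sense of Zorn's lemma is a minimal functional. *)
pose below (p q : T) := `[< forall x, sval q x <= sval p x >].
have [||||p pmin] := @Zorn T below.
- by move=> p; apply/asboolP.
- move=> p q r /asboolP pq /asboolP qr; apply/asboolP => x.
  exact: le_trans (qr x) (pq x).
- move=> [p pP] [q qP] /asboolP pq /asboolP qp; apply/eq_exist/funext => x.
  by apply/eqP; rewrite eq_le pq qp.
- move=> A Atot; have [->|/set0P[q0 Aq0]] := eqVneq A set0.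
    by exists (exist P p0 (conj sp0 (fun x => lexx _))).
  pose q (i : {q | A q}) := sval (sval i).
  have lbq x i : - p0 (- x) <= q i x.
    case: i => -[r [sr rp0]] Ar; rewrite /q /=.
    by have := sublinear_oppr sr x; have := rp0 (- x); lra.
  have infle x i : inf (range (q ^~ x)) <= q i x.
    apply: ge_inf; last by exists i.
    by exists (- p0 (- x)) => _ [j _ <-].
  have sq : sublinear (fun x => inf (range (q ^~ x))).
    apply: (sublinear_inf (exist _ q0 Aq0)).
    + by move=> x; exists (- p0 (- x)).
    + move=> i j x y.
      have [/asboolP ij|/asboolP ji] := Atot _ _ (svalP i) (svalP j).
        exists j; apply: (le_trans ((svalP (sval j)).1.1 x y)).
        by rewrite lerD2r; exact: ij.
      exists i; apply: (le_trans ((svalP (sval i)).1.1 x y)).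
      by rewrite lerD2l; exact: ji.
    + by move=> i a x a0; exists i; exact: (svalP (sval i)).1.2.
  have qp0 x : inf (range (q ^~ x)) <= p0 x.
    by apply: le_trans (infle x (exist _ q0 Aq0)) _; exact: (svalP q0).2.
  exists (exist P _ (conj sq qp0)) => r Ar; apply/asboolP => x.
  exact: (infle x (exist _ r Ar)).
exists (sval p); first exact: (svalP p).1.
split; first exact: (svalP p).2.
move=> q sq qp; have qp0 x := le_trans (qp x) ((svalP p).2 x).
have /= <- // := pmin (exist P q (conj sq qp0)).
exact/asboolP.
Qed.

End Sublinear.

(** * Norming functionals *)

Section HahnBanach.
Context {R : realType} {X : normedModType R}.

Lemma sublinear_norm : sublinear (fun x : X => `|x|).
Proof.
split=> [x y|a x a0]; first exact: ler_normD.
by rewrite normrZ ger0_norm.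
Qed.

(** The minimal functional is taken below [directional_inf] of the norm at [x0], not just below the
    norm: [t = 1] gives the value at [- x0] the bound [- |x0|], which forces [f x0 >= |x0|]. *)
Lemma norming_functional (x0 : X) :
  exists2 f : {linear X -> R^o}, (forall x, `|f x| <= `|x|) & f x0 = `|x0|.
Proof.
have sd := sublinear_directional_inf x0 sublinear_norm.
have [p sp [pd pmin]] := minimal_sublinear_exists sd.
pose f : {linear X -> R^o} := HB.pack (p : X -> R^o)
  (GRing.isLinear.Build R X R^o *:%R p (minimal_sublinear_linear sp pmin)).
have f_le x : f x <= `|x|.
  apply: (le_trans (pd x)).
  have := directional_inf_le x0 x sublinear_norm (lexx 0).
  by rewrite scale0r mul0r addr0 subr0.
have fN x : f (- x) = - f x by exact: linearN.
have f_norm x : `|f x| <= `|x|.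
  by rewrite ler_norml f_le andbT lerNl -fN -normrN f_le.
exists f => //; apply/eqP; rewrite eq_le f_le /= -lerN2 -fN.
apply: (le_trans (pd (- x0))).
have := directional_inf_le x0 (- x0) sublinear_norm ler01.
by rewrite scale1r mul1r addNr normr0 sub0r.
Qed.

Lemma dual_sphere_norming (x0 : X) : (exists x : X, x != 0) ->
  exists2 f, dual_sphere X f & f x0 = `|x0|.
Proof.
(* At [x0 = 0] any member of the dual sphere will do, and a non-zero vector provides one. *)
move=> X_neq0; wlog x0_neq0 : x0 / x0 != 0.
  move=> H; have [->|] := eqVneq x0 0; last exact: H.
  have [x x_neq0] := X_neq0; have [f fS _] := H x x_neq0.
  by exists f; rewrite // linear0 normr0.
have [f f_norm fx0] := norming_functional x0; exists f => //; split.
  apply/bounded_linear_continuous/bounded_funP => r.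
  by exists r => x; exact: le_trans.
have ub : ubound [set `|f x| | x in unit_ball X] 1.
  by move=> _ [x x1 <-]; exact: le_trans (f_norm x) x1.
have n0 : `|x0| != 0 by rewrite normr_eq0.
have top : [set `|f x| | x in unit_ball X] 1.
  exists (`|x0|^-1 *: x0); last first.
    by rewrite linearZ /= fx0 normrM normr_id normfV normr_id mulVf.
  by rewrite /unit_ball /= normrZ normfV normr_id mulVf.
apply/eqP; rewrite eq_le ge_sup //=; last by exists 1.
by apply: sup_upper_bound => //; split; exists 1.
Qed.

End HahnBanach.

(** * Almost square spaces and the strong diameter two property *)

Section AlmostSquare.
Context {R : realType} {X : normedModType R}.

Lemma almost_squareP : almost_square X <->
  forall (k : nat) (x : 'I_k -> X) (e : R),
    (forall i, unit_sphere X (x i)) -> 0 < e ->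
  exists y, [/\ `|y| <= 1, 1 - e <= `|y| &
    forall i, `|x i + y| <= 1 + e /\ `|x i - y| <= 1 + e].
Proof.
split=> [asq k x e xS e0|asq k x xS].
  have [y [yB y1 xy]] := asq k x xS.
  have : \forall n \near \oo, forall i,
      `|x i + y n| <= 1 + e /\ `|x i - y n| <= 1 + e.
    apply: filter_forall => i; have [xDy xBy] := xy i.
    near=> n; split.
      have : `|1 - `|x i + y n| | <= e by near: n; exact: cvgr_dist_le.
      by rewrite ler_norml; lra.
    have : `|1 - `|x i - y n| | <= e by near: n; exact: cvgr_dist_le.
    by rewrite ler_norml; lra.
  move=> xyn; near \oo => n; exists (y n); split; first exact: yB.
    have : `|1 - `|y n| | <= e by near: n; exact: cvgr_dist_le.
    by rewrite ler_norml; lra.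
  by near: n.
(* The sequence takes its [n]-th term from the tolerance [harmonic n]. *)
have /choice[y yP] n := asq k x (harmonic n) xS (harmonic_gt0 n).
have cvg1 (s : R) : 1 + s * harmonic n @[n --> \oo] --> (1 : R).
  rewrite -[X in _ --> X]addr0 -(mulr0 s).
  apply: cvgD; first exact: cvg_cst.
  by apply: cvgMr; exact: cvg_harmonic.
exists y; split=> [n||i]; first by have [] := yP n.
  apply: (@squeeze_cvgr _ _ _ _ (fun n => 1 + (-1) * harmonic n) (fun=> 1)) => //;
    last exact: cvg_cst.
  by apply: nearW => n; have [y1 yn _] := yP n; rewrite mulN1r yn.
(* Upper bounds on both norms suffice: their sum is at least [2 * |x i|], so each norm is also at
   least [1 - harmonic n]. *)
have sum2 n : 2 <= `|x i + y n| + `|x i - y n|.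
  have := ler_normD (x i + y n) (x i - y n).
  rewrite addrACA subrr addr0 -mulr2n normrMn; have -> : `|x i| = 1 := xS i.
  by [].
split; apply: (@squeeze_cvgr _ _ _ _ (fun n => 1 + (-1) * harmonic n)
    (fun n => 1 + 1 * harmonic n)) => //; apply: nearW => n;
  by have [_ _ /(_ i)[? ?]] := yP n; have := sum2 n; lra.
Unshelve. all: by end_near. Qed.

(* [a *: x + b *: y] has coordinates [(a + b) / 2] and [(a - b) / 2] with respect
   to [x + y] and [x - y]. *)
Lemma norm_combination_le (x y : X) (c a b : R) :
  `|x + y| <= c -> `|x - y| <= c ->
  `|a *: x + b *: y| <= c * Num.max `|a| `|b|.
Proof.
move=> xDy xBy.
have -> : a *: x + b *: y = ((a + b) / 2) *: (x + y) + ((a - b) / 2) *: (x - y).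
  rewrite !scalerDr scalerN addrACA -scalerBl -scalerDl.
  have -> : (a + b) / 2 + (a - b) / 2 = a by field.
  by have -> : (a + b) / 2 - (a - b) / 2 = b by field.
apply: (le_trans (ler_normD _ _)).
rewrite (normrZ ((a + b) / 2)) (normrZ ((a - b) / 2)).
have c0 : 0 <= c := le_trans (normr_ge0 _) xDy.
have max_ab : `|(a + b) / 2| + `|(a - b) / 2| <= Num.max `|a| `|b|.
  have := ler_norm a; have := ler_norm (- a).
  have := ler_norm b; have := ler_norm (- b).
  rewrite !normrN le_max; case: (ger0P ((a + b) / 2)); case: (ger0P ((a - b) / 2));
  by case: (leP `|b| `|a|) => /=; rewrite ?orbT; lra.
apply: (@le_trans _ _ (c * (`|(a + b) / 2| + `|(a - b) / 2|))); last exact: ler_wpM2l.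
by rewrite mulrDr !(mulrC c) lerD // ler_wpM2l.
Qed.

Lemma almost_square_seq (s : seq X) (e : R) : (exists x : X, x != 0) ->
  almost_square X -> 0 < e ->
  exists y, [/\ `|y| <= 1, 1 - e <= `|y| & forall x b, x \in s ->
    `|x + b *: y| <= (1 + e) * Num.max `|x| `|b|].
Proof.
move=> [x0 x0_neq0] /almost_squareP asq e0.
(* A zero entry has no direction; any unit vector stands in for it, as its coefficient [|x|]
   vanishes. *)
pose z x := if x == 0 then `|x0|^-1 *: x0 else `|x|^-1 *: x.
have unitn (x : X) : x != 0 -> `| `|x|^-1 *: x| = 1.
  by move=> xN0; rewrite normrZ normfV normr_id mulVf // normr_eq0.
have zS x : unit_sphere X (z x).
  by rewrite /unit_sphere /= /z; case: ifPn => [_|]; exact: unitn.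
have [y [y1 ye zy]] := asq (size s) (fun i => z (tnth (in_tuple s) i)) e
  (fun=> zS _) e0.
exists y; split=> // x b /seq_tnthP[i xi].
have [xDy xBy] := zy i.
have {1}-> : x = `|x| *: z x.
  rewrite /z; case: eqVneq => [->|xN0]; first by rewrite normr0 scale0r.
  by rewrite scalerA mulfV ?scale1r // normr_eq0.
by rewrite -[X in Num.max X]normr_id; apply: norm_combination_le; rewrite xi.
Qed.

Lemma dual_sphere_near1 (f : {linear X -> R^o}) (d : R) :
  dual_sphere X f -> 0 < d -> d < 1 -> exists2 x, `|x| = 1 & 1 - d < f x.
Proof.
move=> fS d0 d1; have [_ f1] := fS.
have [|_ [x x1 <-]] := @sup_adherent R [set `|f x| | x in unit_ball X] d d0.
  split; first by exists `|f 0|, 0; rewrite // /unit_ball /= normr0.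
  by exists 1 => _ [x x1 <-]; exact: le_trans (dual_sphere_le x fS) x1.
rewrite -/(dual_norm f) f1 => fx.
(* [d < 1] makes [x] non-zero. It is then normalised, and its sign is changed if [f x < 0]. *)
have xgt0 : 0 < `|x| by apply: lt_le_trans (dual_sphere_le x fS); lra.
have fx' : 1 - d < `|f x| / `|x|.
  by apply: (lt_le_trans fx); rewrite ler_peMr // invf_ge1.
have nx (t : R) : `|t| = 1 -> `|(t / `|x|) *: x| = 1.
  by move=> t1; rewrite normrZ normrM t1 mul1r normfV normr_id mulVf // gt_eqF.
have [f0|f0] := leP 0 (f x).
  exists ((1 / `|x|) *: x); first by rewrite nx // normr1.
  by move: fx'; rewrite ger0_norm // linearZ /= -[_ *: _]/(_ * _) mul1r mulrC.
exists ((-1 / `|x|) *: x); first by rewrite nx // normrN1.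
move: fx'; rewrite ltr0_norm // linearZ /= -[_ *: _]/(_ * _).
by rewrite mulN1r !mulNr (mulrC _ (f x)).
Qed.

Lemma almost_square_strong_diameter_two :
  almost_square X -> strong_diameter_two X.
Proof.
move=> /almost_squareP asq n lam S slS lam0 lam1; set C := (X in diameter X).
have slP i : exists fa : {linear X -> R^o} * R, [/\ dual_sphere X fa.1, 0 < fa.2 &
    S i = [set x | unit_ball X x /\ 1 - fa.2 < fa.1 x]].
  by have [f [a H]] := slS i; exists (f, a).
have {slP slS}[fa faP] := choice slP.
have inball (s : 'I_n -> X) : (forall i, S i (s i)) -> `|\sum_i lam i *: s i| <= 1.
  move=> sS; apply: (le_trans (ler_norm_sum _ _ _)); rewrite -lam1.
  apply: ler_sum => i _; rewrite normrZ ger0_norm // ler_piMr //.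
  by have [_ _ SE] := faP i; have := sS i; rewrite SE => -[].
apply/eqP; rewrite eq_le; apply/andP; split.
  apply: ge_ereal_sup => _ [u [s sS <-] [v [t tS <-] <-]]; rewrite lee_fin.
  apply: (le_trans (ler_normB _ _)).
  by have := inball _ sS; have := inball _ tS; lra.
have large (e : R) : 0 < e -> e < 1 -> (forall i, 4 * e < (fa i).2) ->
    ((2 * (1 - e) / (1 + e))%:E <= diameter C)%E.
  move=> e0 e1 ea.
  have xP i : exists x, `|x| = 1 /\ 1 - e < (fa i).1 x.
    have [fS _ _] := faP i.
    by have [x ? ?] := dual_sphere_near1 fS e0 e1; exists x.
  have {xP}[x xP] := choice xP.
  have [|y [y1 ye xy]] := asq n x e _ e0; first by move=> i; have [] := xP i.
  have e_gt0 : 0 < 1 + e by lra.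
  have inS (t : R) : `|t| = 1 -> (forall i, `|x i + t *: y| <= 1 + e) ->
      forall i, S i ((1 + e)^-1 *: (x i + t *: y)).
    move=> t1 xty i; have [fS a0 ->] := faP i; have [x1 fx] := xP i.
    split.
      by rewrite /unit_ball /= normrZ gtr0_norm ?invr_gt0 // ler_pdivrMl // mulr1.
    (* From [f x > 1 - e] and [f (x +- y) <= 1 + e] follows [|f y| < 2 * e]. After rescaling, the
       value exceeds [(1 - 3 * e) / (1 + e) >= 1 - 4 * e], whence the condition
       [4 * e < (fa i).2]. *)
    set f := (fa i).1 in fS fx *.
    have fD := le_trans (ler_norm _) (le_trans (dual_sphere_le (x i + y) fS) (xy i).1).
    have fB := le_trans (ler_norm _) (le_trans (dual_sphere_le (x i - y) fS) (xy i).2).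
    rewrite !linearE /= in fD fB.
    have fty : - (2 * e) < t * f y.
      have : `|t * f y| < 2 * e by rewrite normrM t1 mul1r ltr_norml; lra.
      by rewrite ltr_norml => /andP[].
    rewrite linearZ linearD linearZ /= -[_ *: _]/(_ * _) -[t *: _]/(t * _).
    rewrite ltr_pdivlMl //; have := ea i; nra.
  have inS1 := inS 1 (normr1 _); have inSN1 := inS (-1) (normrN1 _).
  rewrite scale1r in inS1; rewrite scaleN1r in inSN1.
  have {}inS1 := inS1 (fun i => (xy i).1); have {}inSN1 := inSN1 (fun i => (xy i).2).
  apply: (@le_trans _ _ (`|\sum_i lam i *: ((1 + e)^-1 *: (x i + y))
      - \sum_i lam i *: ((1 + e)^-1 *: (x i - y))|)%:E); last first.
    apply: ereal_sup_ubound.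
    exists (\sum_i lam i *: ((1 + e)^-1 *: (x i + y))).
      by exists (fun i => (1 + e)^-1 *: (x i + y)).
    exists (\sum_i lam i *: ((1 + e)^-1 *: (x i - y))) => //.
    by exists (fun i => (1 + e)^-1 *: (x i - y)).
  (* The same [y] serves every slice and the weights sum to 1, so the two combinations differ by
     [2 y / (1 + e)]. *)
  have dE i : x i + y - (x i - y) = y *+ 2.
    by rewrite opprB addrC subrKA -mulr2n.
  rewrite lee_fin -sumrB.
  under eq_bigr => i _ do rewrite -scalerBr -scalerBr dE.
  rewrite -scaler_suml lam1 scale1r normrZ normfV (gtr0_norm e_gt0) normrMn.
  by rewrite mulrC ler_wpM2l ?invr_ge0 ?(ltW e_gt0) // -mulr_natl; lra.
apply/lee_addgt0Pr => d d0.
have small : \forall e \near 0^'+, forall i, e < (fa i).2 / 4.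
  apply: filter_forall => i; apply: nbhs_right_lt.
  by rewrite divr_gt0 //; have [] := faP i.
near (0 : R)^'+ => e.
have e0 : 0 < e by near: e; exact: nbhs_right_gt.
have e1 : e < 1 by near: e; exact: nbhs_right_lt.
(* This yields [2 - d <= 2 * (1 - e) / (1 + e)]. *)
have ed : e < d / 4 by near: e; apply: nbhs_right_lt; rewrite divr_gt0.
have ea i : 4 * e < (fa i).2.
  by rewrite mulrC -ltr_pdivlMr //; move: i; near: e.
rewrite -leeBlDr //; apply: le_trans (large e e0 e1 ea).
rewrite lee_fin ler_pdivlMr; last by lra.
by have := mulr_gt0 d0 e0; lra.
Unshelve. all: by end_near. Qed.

End AlmostSquare.

(** * Finite nets for bounded sets of linear combinations *)

Section Nets.
Context {R : realType}.

Lemma interval_net (M d : R) : 0 < d ->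
  exists s : seq R, forall t, `|t| <= M -> exists2 a, a \in s & `|t - a| <= d.
Proof.
move=> d0; pose N := Num.trunc ((2 * M) / d).
exists [seq k%:R * d - M | k <- iota 0 N.+1] => t; rewrite ler_norml => /andP[tl tr].
have t0 : 0 <= (t + M) / d by rewrite divr_ge0 ?(ltW d0) //; lra.
have /andP[kl kr] := truncn_itv t0; set k := Num.trunc _ in kl kr.
exists (k%:R * d - M).
  apply/mapP; exists k => //; rewrite mem_iota /= add0n ltnS.
  apply: Num.Theory.le_truncn; rewrite ler_pM2r ?invr_gt0 //; lra.
move: kl kr; rewrite ler_pdivlMr // ltr_pdivrMr // -natr1 mulrDl mul1r => kl kr.
rewrite ler_norml; apply/andP; split; lra.
Qed.

Lemma combination_net (X : normedModType R) (n : nat) (x : 'I_n -> X)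
    (M : 'I_n -> R) (d : R) : 0 < d ->
  exists s : seq X, forall c : 'I_n -> R, (forall i, `|c i| <= M i) ->
    exists2 p, p \in s & `|\sum_i c i *: x i - p| <= d.
Proof.
elim: n x M d => [|n IH] x M d d0.
  exists [:: 0] => c _; exists 0; first by rewrite mem_seq1.
  by rewrite big_ord0 subr0 normr0 ltW.
have d2 : 0 < d / 2 by rewrite divr_gt0.
have [s sP] := IH (fun i => x (lift ord0 i)) (fun i => M (lift ord0 i)) (d / 2) d2.
have x0 : 0 < `|x ord0| + 1 by rewrite ltr_wpDl.
(* Half of the tolerance goes to the first term; the [+ 1] avoids a division by zero when
   [x ord0 = 0]. *)
have [t tP] := interval_net (M ord0) (divr_gt0 d2 x0).
exists [seq a *: x ord0 + p | a <- t, p <- s] => c cM.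
have [p ps pd] := sP (fun i => c (lift ord0 i)) (fun i => cM _).
have [a at' ad] := tP _ (cM ord0).
exists (a *: x ord0 + p); first by apply/allpairsP; exists (a, p).
rewrite big_ord_recl opprD addrACA -scalerBl (splitr d).
apply: (le_trans (ler_normD _ _)); rewrite lerD // normrZ.
apply: (@le_trans _ _ (d / 2 / (`|x ord0| + 1) * (`|x ord0| + 1))).
  by apply: ler_pM => //; rewrite lerDl.
by rewrite divfK // gt_eqF.
Qed.

End Nets.

(** * The injective norm and transfer of almost squareness *)

Section InjectiveTensorProduct.
Context {R : realType} {X Y : normedModType R}.

(* The partial evaluations [(id (x) g) u], for [g] in the dual sphere, form a
   totally bounded set. *)
Lemma partial_evaluation_net (u : tensor X Y) (d : R) : 0 < d ->
  exists s : seq X, forall g, dual_sphere Y g -> exists x p,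
    [/\ p \in s, `|x - p| <= d & forall f, u (form_tens f g) = f x].
Proof.
move=> d0; have [n [x [y ->]]] := tensorP u.
have [s sP] := combination_net x (fun i => `|y i|) d0.
exists s => g gS; have [p ps pd] := sP (g \o y) (fun i => dual_sphere_le _ gS).
exists (\sum_i g (y i) *: x i), p; split=> // f.
rewrite tensor_sumE linear_sum; apply: eq_bigr => i _.
by rewrite linearZ /= /form_tens mulrC.
Qed.

Lemma injective_norm_ge (u : tensor X Y) f g :
  dual_sphere X f -> dual_sphere Y g ->
  `|u (form_tens f g)| <= injective_norm u.
Proof.
move=> fS gS; apply: sup_upper_bound; last by exists f, g.
split; first by exists `|u (form_tens f g)|, f, g.
have [M MP] := Completion.ev_bounded u; exists M => _ [h [k [hS kS ->]]].
exact: (MP (exist _ h hS, exist _ k kS)).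
Qed.

(** [0 <= c] covers an empty dual sphere, where the supremum is 0 by convention. *)
Lemma injective_norm_le (u : tensor X Y) (c : R) : 0 <= c ->
  (forall f g, dual_sphere X f -> dual_sphere Y g -> `|u (form_tens f g)| <= c) ->
  injective_norm u <= c.
Proof.
move=> c0 uc; rewrite /injective_norm.
set A := (X in sup X); have [->|/set0P A0] := eqVneq A set0; first by rewrite sup0.
by apply: ge_sup => // _ [f [g [fS gS ->]]]; exact: uc.
Qed.

Hypotheses (X_neq0 : exists x : X, x != 0) (Y_neq0 : exists y : Y, y != 0).

Lemma injective_norm_tens (x : X) (y : Y) :
  injective_norm (tens x y) = `|x| * `|y|.
Proof.
apply/eqP; rewrite eq_le; apply/andP; split.
  apply: injective_norm_le => [|f g fS gS]; first exact: mulr_ge0.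
  rewrite -[leLHS]/(`|f x * g y|) normrM.
  by apply: ler_pM => //; exact: dual_sphere_le.
have [f fS fx] := dual_sphere_norming x X_neq0.
have [g gS gy] := dual_sphere_norming y Y_neq0.
apply: le_trans (injective_norm_ge _ fS gS).
by rewrite -[leRHS]/(`|f x * g y|) fx gy ger0_norm // mulr_ge0.
Qed.

(** The two additive errors [e] come from replacing a partial evaluation [x] of [u] by a net point
    [p]: one in [|p| <= |x| + e], the other in the leftover [x - p]. *)
Lemma injective_almost_square_seq (us : seq (tensor X Y)) (e : R) :
  almost_square X -> 0 < e ->
  exists w, [/\ injective_norm w <= 1, 1 - e <= injective_norm w &
    forall u b, u \in us -> injective_norm (u + b *: w) <=
      (1 + e) * Num.max (injective_norm u + e) `|b| + e].
Proof.
move=> asq e0.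
have netP u := cid (partial_evaluation_net u e0).
pose s := flatten [seq sval (netP u) | u <- us].
have [y [y1 ye ys]] := almost_square_seq s X_neq0 asq e0.
have [v v1] : exists v : Y, `|v| = 1.
  have [v v_neq0] := Y_neq0; exists (`|v|^-1 *: v).
  by rewrite normrZ normfV normr_id mulVf // normr_eq0.
exists (tens y v); rewrite injective_norm_tens v1 mulr1; split=> // u b uus.
apply: injective_norm_le => [|f g fS gS].
  rewrite addr_ge0 ?(ltW e0) // mulr_ge0 ?addr_ge0 ?(ltW e0) //.
  by rewrite le_max normr_ge0 orbT.
have [x [p [ps xp ux]]] := svalP (netP u) g gS.
have -> : (u + b *: tens y v) (form_tens f g) = f (x + (b * g v) *: y).
  rewrite -[LHS]/(u (form_tens f g) + b * (f y * g v)) ux linearD linearZ /=.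
  by rewrite -[X in _ = _ + X]/(b * g v * f y) mulrAC mulrA.
apply: le_trans (dual_sphere_le _ fS) _.
(* Testing [u] against [h (x) g], with [h] norming [x], gives exactly [|x|]. *)
have xu : `|x| <= injective_norm u.
  have [h hS hx] := dual_sphere_norming x X_neq0.
  by apply: le_trans (injective_norm_ge _ hS gS); rewrite ux hx normr_id.
have -> : x + (b * g v) *: y = p + (b * g v) *: y + (x - p).
  by rewrite [RHS]addrC addrA subrK.
apply: (le_trans (ler_normD _ _)); rewrite lerD //.
have pus : p \in s by apply/flattenP; exists (sval (netP u)) => //; exact: map_f.
apply: (le_trans (ys _ _ pus)); rewrite ler_pM2l ?addr_gt0 // ge_max !le_max.
apply/andP; split; apply/orP; [left|right].
  have := ler_normD (p - x) x; rewrite subrK distrC; lra.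
rewrite normrM ler_piMr //; have := dual_sphere_le v gS; by rewrite v1.
Qed.

Lemma injective_almost_square (Z : completeNormedModType R)
    (j : {linear tensor X Y -> Z}) :
  is_injective_tensor_product j -> almost_square X -> almost_square Z.
Proof.
move=> [jnorm jdense] asq; apply/almost_squareP => k z e zS e0.
(* The final bound is [(1 + d) * (1 + 2 * d) + 2 * d = 1 + 5 * d + 2 * d ^ 2], at most [1 + 7 * d]
   since [d <= 1]. One of the last two [d] is the error of the net, the other that of approximating
   [z i] by [j (u i)]. *)
pose d := Num.min 1 (e / 7).
have d0 : 0 < d by rewrite lt_min ltr01 divr_gt0.
have d1 : d <= 1 by rewrite ge_min lexx.
have de : 7 * d <= e by rewrite mulrC -ler_pdivlMr // ge_min lexx orbT.
have uP i : exists u, `|z i - j u| < d.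
  have [||q [zq [u _ uq]]] := jdense (ball (z i) d).
  - by exists (z i); exact: ballxx.
  - exact: ball_open.
  by exists u; move: zq; rewrite -uq -ball_normE.
have {uP}[u uP] := choice uP.
have [w [w1 wd wu]] := injective_almost_square_seq (codom u) asq d0.
exists (j w); rewrite jnorm; split=> //; first by lra.
move=> i.
have u1 : injective_norm (u i) <= 1 + d.
  rewrite -jnorm; have := ler_normB (z i) (z i - j (u i)).
  have -> : `|z i| = 1 := zS i.
  by rewrite subKr; have := uP i; lra.
have zb b : `|b| = 1 -> `|z i + b *: j w| <= 1 + e.
  move=> b1; have := wu (u i) b (codom_f _ _).
  rewrite -jnorm linearD linearZ b1 => jb.
  have -> : z i + b *: j w = j (u i) + b *: j w + (z i - j (u i)).
    by rewrite [RHS]addrC addrA subrK.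
  apply: (le_trans (ler_normD _ _)).
  have m : Num.max (injective_norm (u i) + d) 1 <= 1 + 2 * d.
    by rewrite ge_max; apply/andP; split; lra.
  have {m} : (1 + d) * Num.max (injective_norm (u i) + d) 1 <= (1 + d) * (1 + 2 * d).
    by rewrite ler_pM2l // addr_gt0.
  by have := uP i; nra.
by rewrite -{1}[j w]scale1r -scaleN1r !zb ?normrN1 ?normr1.
Qed.

End InjectiveTensorProduct.

Theorem corollary2p7 (R : realType) (X Y Z : completeNormedModType R)
    (j : {linear tensor X Y -> Z})
    (X_neq0 : exists x : X, x != 0) (Y_neq0 : exists y : Y, y != 0)
    (Z_XY : is_injective_tensor_product j) :
  almost_square X -> almost_square Z /\ strong_diameter_two Z.
Proof.
move=> asq; have asqZ := injective_almost_square X_neq0 Y_neq0 Z_XY asq.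
by split=> //; exact: almost_square_strong_diameter_two.
Qed.
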